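(* Let $J\subset\mathbb R$ be an interval, let $A$ be a continuous real $n\times n$ matrix function on $J$ that is diagonalizable by a constant similarity matrix, let $f\colon J\to\mathbb R^n$ be continuous, and let $B(t)=A(t)^{T}$. Suppose $\nu$ is a real (constant) eigenvector of the matrix $B(t)$, $t\in J$, corresponding to the eigenfunction $\lambda\colon J\to\mathbb R$, i.e. $B(t)\nu=\lambda(t)\nu$ for all $t\in J$. Fix $t_0\in J$ and put $\varphi(t)=\exp\bigl(-\int_{t_0}^{t}\lambda(\zeta)\,d\zeta\bigr)$ for $t\in J$. Then the system $\dfrac{dx}{dt}=A(t)x+f(t)$ has the first integral $$F\colon(t,x)\mapsto\nu x\,\varphi(t)-\int_{t_0}^{t}\nu f(\zeta)\,\varphi(\zeta)\,d\zeta\quad\text{for all }(t,x)\in J\times\mathbb R^n.$$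
   Context: For a vector $\nu=(\nu_1,\dots,\nu_n)$ and $x\in\mathbb R^n$, $\nu x=\sum_{\xi=1}^n\nu_\xi x_\xi$; eigenvectors are non-zero and regarded as columns in $B(t)\nu=\lambda(t)\nu$. ''$A$ is diagonalizable by a constant similarity matrix'' means that there is a constant nonsingular matrix $S$ such that $S^{-1}A(t)S$ is diagonal for all $t\in J$ (such systems are called algebraic reducible). A first integral of $dx/dt=X(t,x)$ on a domain $G'$ is a continuously differentiable function $F\colon G'\to\mathbb R$ with $\partial_tF(t,x)+\sum_{\xi=1}^nX_\xi(t,x)\,\partial_{x_\xi}F(t,x)=0$ for all $(t,x)\in G'$. *)

(* Defs.v *)
From HB Require Import structures.
From mathcomp Require Import all_boot all_order all_algebra.
From mathcomp Require Import complex.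
From mathcomp Require Import all_classical all_reals all_analysis.
Import Order.TTheory GRing.Theory Num.Theory.
Import numFieldNormedType.Exports.

Set Implicit Arguments.
Unset Strict Implicit.
Unset Printing Implicit Defensive.

Local Open Scope classical_set_scope.
Local Open Scope ring_scope.

(* The similarity matrix S is allowed to be complex although A is real; a real
   S is a special case. Writing "S is real" instead would only strengthen this
   condition. *)
Definition diagonalizable_by_constant (R : realType) (n : nat) (J : set R)
    (A : R -> 'M[R]_n) : Prop :=
  exists2 S : 'M[R[i]]_n, S \in unitmx
    & forall t, J t ->
        is_diag_mx (invmx S *m map_mx (real_complex R) (A t) *m S).

Definition lin_form (R : realType) (n : nat) (nu x : 'cV[R]_n) : R :=
  \sum_(i < n) nu i 0 * x i 0.

(* The integral of g from a to b, with the usual sign when b < a. *)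
Definition oriented_integral (R : realType) (a b : R) (g : R -> R) : R :=
  if a <= b then Rintegral (@lebesgue_measure R) `[a, b] g
  else - Rintegral (@lebesgue_measure R) `[b, a] g.

(* The derivative of g at a, with increments restricted to keep a + h in D:
   one-sided at an endpoint of an interval, the ordinary derivative at an
   interior point. The value d is unique unless a is isolated in D. *)
Definition is_derive_in (R : realType) (D : set R) (g : R -> R) (a d : R) :
    Prop :=
  (fun h => (g (a + h) - g a) / h) @ within [set h | D (a + h)] 0^' --> d.

(* F only matters on G; a point of R * 'cV_n is (t, x). Ft and Fx i are the
   partial derivatives of F in t and in the i-th coordinate of x. *)
Definition is_first_integral (R : realType) (n : nat)
    (X : R -> 'cV[R]_n -> 'cV[R]_n) (G : set (R * 'cV[R]_n))
    (F : R * 'cV[R]_n -> R) : Prop :=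
  exists (Ft : R * 'cV[R]_n -> R) (Fx : 'I_n -> R * 'cV[R]_n -> R),
    [/\ [/\ {within G, continuous F},
            {within G, continuous Ft}
          & forall i, {within G, continuous (Fx i)}],
        forall t x, G (t, x) ->
          is_derive_in [set s | G (s, x)] (fun s => F (s, x)) t (Ft (t, x)),
        forall i t x, G (t, x) ->
          is_derive_in [set h | G (t, x + h *: delta_mx i 0)]
            (fun h => F (t, x + h *: delta_mx i 0)) 0 (Fx i (t, x))
      & forall t x, G (t, x) ->
          Ft (t, x) + \sum_(i < n) X t x i 0 * Fx i (t, x) = 0].

(* Main.v *)
(* Since A(t)^T nu = lambda(t) nu, the function nu x satisfies the scalar linear
   equation y' = lambda y + nu f along solutions, and phi is its integrating
   factor. The eigenfunction lambda inherits the continuity of A, being a fixed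
   linear function of A(t) (divide by a nonzero coordinate of nu), so that the
   integrals can be differentiated at every point of J, relatively to J at an
   endpoint. *)
Require Import Defs.
From HB Require Import structures.
From mathcomp Require Import all_boot all_order all_algebra.
From mathcomp Require Import all_classical all_reals all_analysis.
From mathcomp Require Import ring.
Import Order.TTheory GRing.Theory Num.Theory.
Import numFieldNormedType.Exports.

Set Implicit Arguments.
Unset Strict Implicit.
Unset Printing Implicit Defensive.

Local Open Scope classical_set_scope.
Local Open Scope ring_scope.

Lemma cvg_eq_near (T : Type) (U : topologicalType) (F : set_system T)
    {FF : Filter F} (f g : T -> U) (l : U) :
  f @ F --> l -> (\forall x \near F, f x = g x) -> g @ F --> l.
Proof.
by move=> fl fg; apply: cvg_trans fl; apply: near_eq_cvg.
Qed.

(** * Calculus of derivatives relative to a set *)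

Section DerivativeWithinSet.
Variable R : realType.
Implicit Types (D : set R) (g u v : R -> R).

(** For [h != 0] the value [g (a + h)] is [g a] plus [h] times the difference quotient, and this
    product tends to [0 * d]. *)
Lemma is_derive_in_cvg D g a d : is_derive_in D g a d ->
  (fun h => g (a + h)) @ within [set h | D (a + h)] 0^' --> g a.
Proof.
move=> gd.
have h0 : (fun h : R => h) @ within [set h | D (a + h)] 0^' --> 0.
  exact: (cvg_trans (cvg_within _) (@nbhs_dnbhs _ _)).
have -> : g a = g a + 0 * d by rewrite mul0r addr0.
apply: (cvg_eq_near (cvgD (cvg_cst _) (cvgM h0 gd))).
rewrite !near_withinE; near=> h => /= hn0 _.
by rewrite !fctE /= mulrC divfK// addrC subrK.
Unshelve. all: by end_near. Qed.

(** The preceding limit is over the punctured neighbourhood; at the point [a] itself the distance to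
    [g a] is zero, so the limit extends to the full one. *)
Lemma is_derive_in_continuous D g a d : is_derive_in D g a d ->
  g @ within D (nbhs a) --> g a.
Proof.
move=> /is_derive_in_cvg/cvgrPdist_lt gc; apply/cvgrPdist_lt => e e0.
have := gc _ e0; rewrite !near_withinE => /nbhs_ballP[r /= r0 gr].
apply/nbhs_ballP; exists r => //= x axr Dx.
have [->|xa] := eqVneq x a; first by rewrite subrr normr0.
have := gr (x - a); rewrite /ball /= sub0r opprB subrKC.
by apply; rewrite ?subr_eq0.
Qed.

Lemma is_derive_in_cst D (c a : R) : is_derive_in D (fun=> c) a 0.
Proof.
apply: (cvg_eq_near (cvg_cst 0)); apply: nearW => h.
by rewrite subrr mul0r.
Qed.

Lemma is_derive_inN D u a du :
  is_derive_in D u a du -> is_derive_in D (fun x => - u x) a (- du).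
Proof.
move=> hu; apply: (cvg_eq_near (cvgN hu)); apply: nearW => h.
by rewrite !fctE /=; ring.
Qed.

Lemma is_derive_inB D u v a du dv :
  is_derive_in D u a du -> is_derive_in D v a dv ->
  is_derive_in D (fun x => u x - v x) a (du - dv).
Proof.
move=> hu hv; apply: (cvg_eq_near (cvgB hu hv)).
by apply: nearW => h; rewrite !fctE /= -mulrBl; congr (_ / _); ring.
Qed.

Lemma is_derive_inM D u v a du dv :
  is_derive_in D u a du -> is_derive_in D v a dv ->
  is_derive_in D (fun x => u x * v x) a (du * v a + u a * dv).
Proof.
move=> hu hv.
apply: (cvg_eq_near
  (cvgD (cvgM hu (cvg_cst (v a))) (cvgM (is_derive_in_cvg hu) hv))).
by apply: nearW => h; rewrite !fctE /=; ring.
Qed.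

(** The quotient of the composite factors as [q (k h)] times the quotient of [u], where [k h] is the
    increment of [u] and [q] the quotient of [g]. *)
Lemma is_derive_in_comp D g u a du dg :
  is_derive_in D u a du -> is_derive_in [set: R] g (u a) dg ->
  is_derive_in D (fun x => g (u x)) a (dg * du).
Proof.
move=> hu hg.
pose k h := u (a + h) - u a.
(* The removable singularity of the difference quotient of g is filled in,
   because k h may vanish for h != 0. *)
pose q y := if y == 0 then dg else (g (u a + y) - g (u a)) / y.
have q0 : q @ nbhs (0 : R) --> dg.
  apply/cvgrPdist_lt => e e0.
  move/cvgrPdist_lt: hg => /(_ _ e0); rewrite !near_withinE near_simpl.
  apply: filterS => y /=; rewrite /q; case: eqVneq => [_ _|y0]; last exact.
  by rewrite subrr normr0.
have k0 : k @ within [set h | D (a + h)] 0^' --> u a - u a.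
  exact: (cvgB (is_derive_in_cvg hu) (cvg_cst (u a))).
rewrite subrr in k0.
apply: (cvg_eq_near (cvgM (cvg_comp _ _ k0 q0) hu)); apply: nearW => h.
rewrite !fctE /= -/(k h) /q; have [k0h|kn0] := eqVneq (k h) 0.
  have -> : u (a + h) = u a by apply/eqP; rewrite -subr_eq0 -/(k h) k0h.
  by rewrite k0h subrr mul0r mulr0.
by rewrite mulrA divfK// /k subrKC.
Qed.

Lemma is_derive_in_expR (y : R) : is_derive_in [set: R] expR y (expR y).
Proof.
rewrite /is_derive_in.
have -> : [set h : R | [set: R] (y + h)] = setT by apply/seteqP; split.
rewrite withinET.
(* The library derivative is the limit of [h^-1 *: (expR (h *: 1 + y) - expR y)], the same quotient
   up to notation. *)
have [dE dv] := is_derive_expR y; move: dE dv.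
rewrite /derivable /derive => dE dv; rewrite dv in dE.
apply: (cvg_eq_near dE); apply: nearW => h /=.
by rewrite {1}/GRing.scale /= mulrC [h *: 1]mulr1 (addrC y).
Qed.

End DerivativeWithinSet.

(** * Oriented integrals and the fundamental theorem of calculus on an interval *)

Section OrientedIntegral.
Variable R : realType.
Local Notation mu := (@lebesgue_measure R).
Implicit Types (J : set R) (g : R -> R).

Lemma oriented_integral_le g (a b : R) : a <= b ->
  oriented_integral a b g = Rintegral mu `[a, b] g.
Proof. by rewrite /oriented_integral => ->. Qed.

Lemma oriented_integralC g (a b : R) :
  oriented_integral b a g = - oriented_integral a b g.
Proof.
rewrite /oriented_integral; case: (ltgtP a b) => [||->]; rewrite ?opprK//.
by rewrite set_itv1 Rintegral_set1 oppr0.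
Qed.

(** By convexity [J] contains the segment, which is compact, so that continuity on it gives
    integrability. *)
Lemma within_integrable J g (a b : R) : is_interval J ->
  {within J, continuous g} -> J a -> J b ->
  mu.-integrable `[a, b] (EFin \o g).
Proof.
move=> iJ cg Ja Jb; apply: continuous_compact_integrable.
  exact: segment_compact.
apply: continuous_subspaceW cg => x /=; rewrite in_itv /= => axb.
exact: iJ Ja Jb _ axb.
Qed.

(** Chasles relation: the ordered case is [mid]; every other order of the points reduces to it by
    reversing integrals. *)
Lemma oriented_integralD J g (a b c : R) : is_interval J ->
  {within J, continuous g} -> J a -> J b -> J c ->
  oriented_integral a c g = oriented_integral a b g + oriented_integral b c g.
Proof.
move=> iJ cg.
have mid x y z : J x -> J z -> x <= y -> y <= z ->
    oriented_integral x z g =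
    oriented_integral x y g + oriented_integral y z g.
  move=> Jx Jz xy yz; rewrite !oriented_integral_le ?(le_trans xy)//.
  have := @Rintegral_itvB _ g (BLeft x) (BRight z) y
    (within_integrable iJ cg Jx Jz).
  rewrite !bnd_simp => /(_ xy yz) H; apply/eqP; rewrite addrC -subr_eq H.
  (* The difference of the integrals is over the interval open at [y]; adding this endpoint does not
     change the value. *)
  rewrite Rintegral_itv_obnd_cbnd//.
  apply: integrableS (within_integrable iJ cg Jx Jz) => //.
  by apply: subset_itvr; rewrite bnd_simp.
move=> Ja Jb Jc; case: (leP a b) => ab; case: (leP b c) => bc.
- exact: mid.
- case: (leP a c) => ac.
    by rewrite (oriented_integralC g c b) (mid a c b)// ?(ltW bc)// addrK.
  rewrite (oriented_integralC g c b) (oriented_integralC g c a).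
  by rewrite (mid c a b)// ?(ltW ac)// opprD addrC subrK.
- case: (leP a c) => ac.
    by rewrite (oriented_integralC g b a) (mid b a c)// ?(ltW ab)// addKr.
  rewrite (oriented_integralC g b a) (oriented_integralC g c a).
  by rewrite (mid b c a)// ?(ltW ac)// opprD addrAC addNr add0r.
- rewrite (oriented_integralC g b a) (oriented_integralC g c b).
  by rewrite (oriented_integralC g c a) (mid c b a) ?ltW// opprD addrC.
Qed.

(** Quantitative core of the fundamental theorem: integrate [c - e <= g <= c + e] over the
    segment. *)
Lemma dist_oriented_integral_le J g (a b c e : R) : is_interval J ->
  {within J, continuous g} -> J a -> J b ->
  (forall x, J x -> `|x - a| <= `|b - a| -> `|c - g x| <= e) ->
  `|c * (b - a) - oriented_integral a b g| <= e * `|b - a|.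
Proof.
move=> iJ cg.
have base x y : J x -> J y -> x <= y ->
    (forall z, x <= z <= y -> `|c - g z| <= e) ->
    `|c * (y - x) - oriented_integral x y g| <= e * (y - x).
  move=> Jx Jy xy ge; rewrite oriented_integral_le//.
  have Ig := within_integrable iJ cg Jx Jy.
  have Ic r : mu.-integrable `[x, y] (EFin \o (fun=> r)).
    apply: continuous_compact_integrable; first exact: segment_compact.
    by apply: continuous_subspaceT => z; exact: cvg_cst.
  have Ec r : Rintegral mu `[x, y] (fun=> r) = r * (y - x).
    rewrite Rintegral_cst//= (lebesgue_measure_itv `[x, y]) /= lte_fin.
    by rewrite lt_neqAle xy andbT; case: eqVneq => //= ->; rewrite subrr.
  (* The two bounds [(c - e) (y - x)] and [(c + e) (y - x)] become integrals of constants, so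
     monotonicity of the integral applies. *)
  rewrite ler_distlC -mulrBl -mulrDl -!Ec.
  apply/andP; split; apply: le_Rintegral => // z /=;
    by rewrite in_itv /= => /ge; rewrite ler_distlC => /andP[].
move=> Ja Jb ge; case: (leP a b) => ab.
  rewrite [`|b - a|]ger0_norm ?subr_ge0//; apply: base => // z /andP[az zb].
  apply: ge; first by apply: iJ Ja Jb _ _; rewrite az.
  by rewrite !ger0_norm ?subr_ge0// lerD2r.
(* Exchanging the endpoints reverses the sign of both terms and keeps the absolute value. *)
rewrite (oriented_integralC g b a) distrC -(opprB a b) mulrN opprK addrC.
rewrite normrN [`|a - b|]gtr0_norm ?subr_gt0//.
apply: base; rewrite ?ltW// => z /andP[bz za].
apply: ge; first by apply: iJ Jb Ja _ _; rewrite bz.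
by rewrite ler0_norm ?subr_le0// ltr0_norm ?subr_lt0// lerN2 lerD2r.
Qed.

(** Additivity leaves the integral from [t] to [t + h]; its quotient by [h] is within [e] of [g t]
    once [g] is so at all points of [J] at distance at most [|h|] from [t]. *)
Lemma is_derive_in_oriented_integral J g (a t : R) : is_interval J ->
  {within J, continuous g} -> J a -> J t ->
  is_derive_in J (fun s => oriented_integral a s g) t (g t).
Proof.
move=> iJ cg Ja Jt; apply/cvgrPdist_le => e e0.
have /subspace_continuousP/(_ t Jt)/cvgrPdist_le/(_ _ e0) := cg.
rewrite !near_withinE near_simpl => /nbhs_ballP[d /= d0 gd].
apply/nbhs_ballP; exists d => //= h; rewrite /ball /= sub0r normrN => hd hn0 Jh.
rewrite (oriented_integralD iJ cg Ja Jt Jh) addrAC subrr add0r.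
have := @dist_oriented_integral_le J g t (t + h) (g t) e iJ cg Jt Jh.
have -> : t + h - t = h by rewrite addrC addKr.
have -> : g t - oriented_integral t (t + h) g / h =
  (g t * h - oriented_integral t (t + h) g) / h by rewrite mulrBl mulfK.
rewrite normrM normfV ler_pdivrMr ?normr_gt0//; apply => x Jx xh.
by apply: gd => //; rewrite /ball /= distrC (le_lt_trans xh).
Qed.

End OrientedIntegral.

(** * The linear form of an eigenvector *)

Lemma lin_formD (R : realType) n (nu x y : 'cV[R]_n) :
  lin_form nu (x + y) = lin_form nu x + lin_form nu y.
Proof.
by rewrite -big_split; apply: eq_bigr => i _; rewrite mxE mulrDr.
Qed.

Lemma lin_formZ (R : realType) n (nu x : 'cV[R]_n) a :
  lin_form nu (a *: x) = a * lin_form nu x.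
Proof. by rewrite mulr_sumr; apply: eq_bigr => i _; rewrite mxE mulrCA. Qed.

Lemma lin_form_delta (R : realType) n (nu : 'cV[R]_n) i :
  lin_form nu (delta_mx i 0) = nu i 0.
Proof.
rewrite /lin_form (bigD1 i)//= mxE !eqxx mulr1 big1 ?addr0// => j ji.
by rewrite mxE (negbTE ji) mulr0.
Qed.

Lemma lin_formE (R : realType) n (nu x : 'cV[R]_n) :
  lin_form nu x = (x^T *m nu) 0 0.
Proof. by rewrite mxE; apply: eq_bigr => i _; rewrite mxE mulrC. Qed.

(** Transposition moves the matrix onto [nu]: [(M x)^T nu = x^T (M^T nu)]. *)
Lemma lin_form_eigen (R : realType) n (M : 'M[R]_n) (nu x : 'cV[R]_n) l :
  M^T *m nu = l *: nu -> lin_form nu (M *m x) = l * lin_form nu x.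
Proof.
by move=> E; rewrite !lin_formE trmx_mul -mulmxA E -scalemxAr mxE.
Qed.

Lemma continuous_lin_form (R : realType) n (nu : 'cV[R]_n) :
  continuous (lin_form nu).
Proof.
apply: continuous_big => [|i _ x]; first exact: add_continuous.
exact: (cvgM (cvg_cst (nu i 0)) (@coord_continuous _ _ _ i 0 x)).
Qed.

(** * Continuity on subsets and of the eigenfunction *)

Lemma within_continuous_comp (T U V : topologicalType) (J : set T)
    (f : T -> U) (g : U -> V) :
  {within J, continuous f} -> continuous g ->
  {within J, continuous (g \o f)}.
Proof.
move=> /subspace_continuousP cf cg; apply/subspace_continuousP => x Jx.
exact: cvg_comp (cf x Jx) (cg (f x)).
Qed.

(** Lifts functions of time alone to the domain of the first integral: the first projection carries
    neighbourhoods within the product to neighbourhoods within [J]. *)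
Lemma within_setX_fst (T U V : topologicalType) (J : set T) (g : T -> V) :
  {within J, continuous g} ->
  {within J `*` [set: U], continuous (fun p => g p.1)}.
Proof.
move=> /subspace_continuousP cg; apply/subspace_continuousP => -[t x] [/= Jt _].
apply: (@cvg_comp _ _ _ fst g _ (within J (nbhs t))); last exact: cg.
move=> P JP.
have : nbhs (t, x) (fun p => J p.1 -> P p.1).
  exact: (@cvg_fst T U (nbhs t) (nbhs x) _ (fun s => J s -> P s) JP).
by apply: filterS => -[s y] /= sP [Js _]; exact: sP.
Qed.

Lemma continuous_eigenfunction (R : realType) n (J : set R)
    (A : R -> 'M[R]_n) (nu : 'cV[R]_n) (lambda : R -> R) :
  {within J, continuous A} -> nu != 0 ->
  (forall t, J t -> (A t)^T *m nu = lambda t *: nu) ->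
  {within J, continuous lambda}.
Proof.
move=> cA nu0 eA.
have [i nui] : exists i, nu i 0 != 0.
  apply: contrapT => /forallNP nui; move/eqP: nu0; apply.
  by apply/colP => i; rewrite mxE; apply/eqP/negPn/negP/nui.
have lE t : t \in J -> (\sum_j A t j i * nu j 0) / nu i 0 = lambda t.
  rewrite inE => /eA /(congr1 (fun v : 'cV_n => v i 0)); rewrite !mxE => lnu.
  rewrite -(mulfK nui (lambda t)) -lnu; congr (_ / _).
  by apply: eq_bigr => j _; rewrite mxE.
(* Row [i] of the eigenvector equation, solved for [lambda t], holds on [J] only, so the replacement
   is made in the subspace topology. *)
apply: (subspace_eq_continuous lE).
apply: (within_continuous_comp (g := fun M : 'M[R]_n =>
  (\sum_j M j i * nu j 0) / nu i 0)) cA _ => M.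
have cs : continuous (fun M : 'M[R]_n => \sum_j M j i * nu j 0).
  apply: continuous_big => [|j _ {}M]; first exact: add_continuous.
  exact: (cvgM (@coord_continuous _ _ _ j i M) (cvg_cst (nu j 0))).
exact: (cvgM (cs M) (cvg_cst (nu i 0)^-1)).
Qed.

Theorem theorem2p1 (R : realType) (n : nat) (J : set R)
    (A : R -> 'M[R]_n) (f : R -> 'cV[R]_n)
    (nu : 'cV[R]_n) (lambda : R -> R) (t0 : R) :
  is_interval J ->
  {within J, continuous A} ->
  diagonalizable_by_constant J A ->
  {within J, continuous f} ->
  let B := fun t => (A t)^T in
  nu != 0 ->
  (forall t, J t -> B t *m nu = lambda t *: nu) ->
  J t0 ->
  let phi := fun t => expR (- oriented_integral t0 t lambda) in
  is_first_integral (fun t x => A t *m x + f t) (J `*` [set: 'cV[R]_n])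
    (fun p => lin_form nu p.2 * phi p.1
       - oriented_integral t0 p.1 (fun s => lin_form nu (f s) * phi s)).
Proof.
move=> iJ cA _ cf B nu0 eB Jt0 phi.
have cl : {within J, continuous lambda} := continuous_eigenfunction cA nu0 eB.
have clf : {within J, continuous (fun s => lin_form nu (f s))}.
  exact: within_continuous_comp cf (@continuous_lin_form _ _ nu).
have dphi t : J t -> is_derive_in J phi t (- lambda t * phi t).
  move=> Jt; rewrite mulrC.
  have dl := is_derive_inN (is_derive_in_oriented_integral iJ cl Jt0 Jt).
  exact: (is_derive_in_comp dl (@is_derive_in_expR _ _)).
have cphi : {within J, continuous phi}.
  by apply/subspace_continuousP => t /dphi/is_derive_in_continuous.
have cg : {within J, continuous (fun s => lin_form nu (f s) * phi s)}.
  by move=> t; apply: cvgM; [exact: clf|exact: cphi].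
pose I t := oriented_integral t0 t (fun s => lin_form nu (f s) * phi s).
have dI t : J t -> is_derive_in J I t (lin_form nu (f t) * phi t).
  by move=> Jt; exact: (is_derive_in_oriented_integral iJ cg Jt0 Jt).
have cI : {within J, continuous I}.
  by apply/subspace_continuousP => t /dI/is_derive_in_continuous.
have cnu : {within J `*` [set: 'cV[R]_n],
    continuous (fun p : R * 'cV[R]_n => lin_form nu p.2)}.
  apply: continuous_subspaceT => p.
  by apply: continuous_comp; [exact: cvg_snd|exact: continuous_lin_form].
(* The slice of the domain at fixed [x] is [J], so the time partial is a derivative relative to
   [J]. *)
have JX x : [set s | (J `*` [set: 'cV[R]_n]) (s, x)] = J.
  by apply/seteqP; split => [s []//|s Js]; split.
(* The time partial comes from [phi' = - lambda phi] and the integrand at the upper limit; the space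
   partials are the coefficients of a form affine in [x]. *)
exists (fun p => - lambda p.1 * phi p.1 * lin_form nu p.2
                 - lin_form nu (f p.1) * phi p.1), (fun i p => nu i 0 * phi p.1).
split; first split.
- move=> p; apply: cvgB; first apply: cvgM; first exact: cnu.
    exact: (within_setX_fst cphi).
  exact: (within_setX_fst cI).
- move=> p; apply: cvgB; last exact: (within_setX_fst cg).
  apply: cvgM; last exact: cnu.
  apply: cvgM; last exact: (within_setX_fst cphi).
  by apply: cvgN; exact: (within_setX_fst cl).
- move=> i p; apply: cvgM; first exact: cvg_cst.
  exact: (within_setX_fst cphi).
- move=> t x [/= Jt _]; rewrite (JX x).
  have := is_derive_inB
    (is_derive_inM (@is_derive_in_cst _ J (lin_form nu x) t) (dphi t Jt))
    (dI t Jt).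
  by rewrite mul0r add0r (mulrC (lin_form nu x)).
- move=> i t x [/= Jt _].
  (* By affinity in [x] the difference quotient is constant for [h != 0]; the integral term
     cancels. *)
  apply: (cvg_eq_near (cvg_cst (nu i 0 * phi t))).
  rewrite !near_withinE; apply: nearW => h /= h0 _.
  rewrite add0r scale0r addr0 lin_formD lin_formZ lin_form_delta.
  by apply: (mulIf h0); rewrite divfK//; ring.
- move=> t x [/= Jt _].
  have -> : \sum_(i < n) (A t *m x + f t) i 0 * (nu i 0 * phi t) =
      lin_form nu (A t *m x + f t) * phi t.
    by rewrite mulr_suml; apply: eq_bigr => i _; rewrite mulrA (mulrC (nu i 0)).
  (* The eigenvector relation turns [nu (A x)] into [lambda (nu x)], and the terms in [lambda] and
     in [nu f] cancel separately. *)
  by rewrite lin_formD (lin_form_eigen _ (eB t Jt)); ring.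
Qed.
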